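(* Let $S_1,S_2,\dots$ be $\mu$-preserving Borel involutions of $X=\{0,1\}^{\mathbb N}$ that form a treeing of the equivalence relation they generate, and let $\Gamma=\langle\gamma_1,\gamma_2,\dots\mid\gamma_i^2=1\ (i\ge1)\rangle$ act on $X$ by $\theta(\gamma_i,x)=S_i(x)$. Then this action (regarded as an action of $\mathbb F_\infty$ through the quotient map $\mathbb F_\infty\to\Gamma$) is sofic. Consequently every treeable measure-preserving equivalence relation on $(X,\mu)$, in particular the orbit relation of any free $\mu$-preserving action of a free group, is sofic.
   Context: $X=\{0,1\}^{\mathbb N}$ with product uniform measure $\mu$. The involutions $S_i$ form a treeing if for $\mu$-a.e. $x$ the graph on the orbit of $x$, with an edge labelled $i$ between $y$ and $S_i(y)$ whenever $S_i(y)\ne y$, is a tree (no cycles, including no two distinct labelled edges joining the same pair of points). An equivalence relation is treeable if it admits such a generating family. $\mathbb F_\infty$ is free on $\gamma_1,\gamma_2,\dots$; $W_r$ the reduced words of length $\le r$ in $\gamma_1^{\pm1},\dots,\gamma_r^{\pm1}$. For an action $\theta$ of $\mathbb F_\infty$ on $X$ or on a finite set $Y$ whose points carry labels in $\{0,1\}^{\mathbb N}$ (points of $X$ labelled by themselves), $B^r_r(x)$ is the rooted directed multigraph on vertex set $\theta(W_r,x)$, root $x$, with an edge $y\to\theta(\gamma_i^\epsilon,y)$ coloured $\gamma_i^\epsilon$ for each vertex $y$, $i\le r$, $\epsilon=\pm1$ with $\theta(\gamma_i^\epsilon,y)$ a vertex, vertices labelled by the first $r$ digits of their labels; $U^{r,r}$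 is the finite set of isomorphism types; $p_\alpha(\theta)$ is the measure (on $X$) resp. proportion (on $Y$) of $x$ with $B^r_r(x)\cong\alpha$. A $\mu$-preserving Borel action $\theta$ on $X$ is sofic if there are actions $\theta_n$ on labelled finite sets with $p_\alpha(\theta_n)\to p_\alpha(\theta)$ for all $r\ge1$, $\alpha\in U^{r,r}$; a $\mu$-preserving countable Borel equivalence relation is sofic if it is the orbit relation of a sofic action. *)

(* Defs.v *)
From HB Require Import structures.
From mathcomp Require Import all_boot all_order all_algebra all_fingroup.
From mathcomp Require Import all_classical all_reals all_analysis.
Set Implicit Arguments. Unset Strict Implicit. Unset Printing Implicit Defensive.
Import Order.TTheory GRing.Theory Num.Theory.
Local Open Scope classical_set_scope.
Local Open Scope ring_scope.

Definition X : measurableType _ := g_sigma_algebraType (@open cantor_space).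

(* mu is the uniform product measure: it gives every cylinder set
   {x | x_j = w_j for j < n} measure 2^-n (this determines mu). *)
Definition uniform_product_measure (R : realType)
    (mu : {measure set X -> \bar R}) : Prop :=
  forall (n : nat) (w : nat -> bool),
    mu [set x : X | forall j, (j < n)%N -> x j = w j] = ((2%:R : R) ^- n)%:E.

Definition measure_preserving (R : realType) (mu : {measure set X -> \bar R})
    (f : X -> X) : Prop :=
  forall A : set X, measurable A -> mu (f @^-1` A) = mu A.

(* Generators gamma_1, gamma_2, ... are indexed from 0: the letter (i, true)
   is gamma_(i+1) and (i, false) is gamma_(i+1)^-1. An action of F_oo on a
   type Y is given by [step i e], the action of the letter (i, e). *)
Definition letter := (nat * bool)%type.

Fixpoint act_word (Y : Type) (step : nat -> bool -> Y -> Y)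
    (w : seq letter) (y : Y) : Y :=
  match w with
  | [::] => y
  | l :: w' => step l.1 l.2 (act_word step w' y)
  end.

Fixpoint reduced_word (w : seq letter) : bool :=
  match w with
  | a :: ((b :: _) as w') => ~~ ((a.1 == b.1) && (a.2 != b.2)) && reduced_word w'
  | _ => true
  end.

Definition in_W (r : nat) (w : seq letter) : bool :=
  [&& reduced_word w, (size w <= r)%N & all (fun l => (l.1 < r)%N) w].

Definition ball_vertices (Y : Type) (step : nat -> bool -> Y -> Y)
    (r : nat) (x : Y) : set Y :=
  [set y | exists w, in_W r w /\ act_word step w x = y].

(* A finite rooted directed multigraph with vertices 'I_rg_n, a root,
   vertex labels in {0,1}^r and, for each vertex v, each i < r and each
   sign e, at most one outgoing edge coloured gamma_(i+1)^(+-1).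
   Every element of U^{r,r} is represented by such an object. *)
Record rgraph (r : nat) := RGraph {
  rg_n : nat;
  rg_root : 'I_rg_n;
  rg_lab : 'I_rg_n -> 'I_r -> bool;
  rg_edge : 'I_rg_n -> 'I_r -> bool -> option 'I_rg_n }.

Definition ball_iso (Y : Type) (step : nat -> bool -> Y -> Y)
    (lab : Y -> nat -> bool) (r : nat) (x : Y) (a : rgraph r) : Prop :=
  exists f : 'I_(rg_n a) -> Y,
    [/\ injective f,
        (forall y, ball_vertices step r x y <-> exists v, f v = y),
        f (@rg_root r a) = x,
        (forall v (j : 'I_r), lab (f v) j = @rg_lab r a v j) &
        (forall v (i : 'I_r) (e : bool),
            match @rg_edge r a v i e with
            | Some u => step i e (f v) = f u
            | None => ~ ball_vertices step r x (step i e (f v))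
            end)].
Arguments ball_iso {Y} step lab r x a.

Definition perm_step (Y : finType) (sigma : nat -> {perm Y}) :
    nat -> bool -> Y -> Y :=
  fun i e => if e then sigma i else ((sigma i)^-1)%g.

Definition p_fin (R : realType) (Y : finType) (sigma : nat -> {perm Y})
    (lab : Y -> nat -> bool) (r : nat) (a : rgraph r) : R :=
  (#|[set y : Y | `[< ball_iso (perm_step sigma) lab r y a >]]|%:R / #|Y|%:R).

Definition p_X (R : realType) (mu : {measure set X -> \bar R})
    (step : nat -> bool -> X -> X) (r : nat) (a : rgraph r) : \bar R :=
  mu [set x : X | ball_iso step (fun x : X => x : nat -> bool) r x a].

Definition sofic_action (R : realType) (mu : {measure set X -> \bar R})
    (step : nat -> bool -> X -> X) : Prop :=
  exists (Y : nat -> finType) (lab : forall n, Y n -> nat -> bool)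
         (sigma : forall n, nat -> {perm Y n}),
    (forall n, (0 < #|Y n|)%N) /\
    forall (r : nat) (a : rgraph r),
      (fun n => (p_fin R (sigma n) (@lab n) a)%:E) @ \oo --> p_X mu step a.

Definition gen_step (g gi : nat -> X -> X) : nat -> bool -> X -> X :=
  fun i e => if e then g i else gi i.

Definition borel_mp_action (R : realType) (mu : {measure set X -> \bar R})
    (g gi : nat -> X -> X) : Prop :=
  forall i, [/\ cancel (g i) (gi i) /\ cancel (gi i) (g i),
               measurable_fun setT (g i), measurable_fun setT (gi i),
               measure_preserving mu (g i) & measure_preserving mu (gi i)].

Definition orbit_rel (step : nat -> bool -> X -> X) (x y : X) : Prop :=
  exists w, act_word step w x = y.

Definition invol_step (S : nat -> X -> X) : nat -> bool -> X -> X :=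
  fun i _ => S i.

Definition borel_mp_involution (R : realType) (mu : {measure set X -> \bar R})
    (f : X -> X) : Prop :=
  [/\ measurable_fun setT f, involutive f & measure_preserving mu f].

Fixpoint walk (S : nat -> X -> X) (y : X) (l : seq nat) : seq X :=
  match l with
  | [::] => [:: y]
  | i :: l' => y :: walk S (S i y) l'
  end.

(* [l] describes a cycle through y in the graph with an edge labelled i
   between z and S_i z whenever S_i z <> z: k = size l >= 1 edges, each step
   is an edge, the walk closes up, the vertices y_0..y_(k-1) are pairwise
   distinct and the labelled (undirected) edges are pairwise distinct. *)
Definition is_cycle (S : nat -> X -> X) (y : X) (l : seq nat) : Prop :=
  let k := size l in
  let v := fun j => nth y (walk S y l) j in
  [/\ (0 < k)%N,
      v k = y,
      (forall j, (j < k)%N -> v j.+1 <> v j),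
      (forall j j', (j < j' < k)%N -> v j <> v j') &
      (forall j j', (j < j' < k)%N ->
         ~ (nth 0%N l j = nth 0%N l j' /\
            ((v j = v j' /\ v j.+1 = v j'.+1) \/
             (v j = v j'.+1 /\ v j.+1 = v j'))))].

(* S forms a treeing: for mu-a.e. x the graph on the orbit of x is a tree,
   i.e. (being connected by construction) has no cycle. *)
Definition treeing (R : realType) (mu : {measure set X -> \bar R})
    (S : nat -> X -> X) : Prop :=
  {ae mu, forall x : X,
     ~ exists y l, orbit_rel (invol_step S) x y /\ is_cycle S y l}.

Definition treeable (R : realType) (mu : {measure set X -> \bar R})
    (E : X -> X -> Prop) : Prop :=
  exists S : nat -> X -> X,
    [/\ (forall i, borel_mp_involution mu (S i)),
        treeing mu S &
        (forall x y, E x y <-> orbit_rel (invol_step S) x y)].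

Definition sofic_relation (R : realType) (mu : {measure set X -> \bar R})
    (E : X -> X -> Prop) : Prop :=
  exists g gi : nat -> X -> X,
    [/\ borel_mp_action mu g gi,
        sofic_action mu (gen_step g gi) &
        (forall x y, E x y <-> orbit_rel (gen_step g gi) x y)].

Definition word_in (J : set nat) (w : seq letter) : Prop :=
  forall l, l \in w -> J l.1.

Definition free_action (R : realType) (mu : {measure set X -> \bar R})
    (J : set nat) (g gi : nat -> X -> X) : Prop :=
  (forall i, J i ->
     [/\ cancel (g i) (gi i) /\ cancel (gi i) (g i),
         measurable_fun setT (g i), measurable_fun setT (gi i),
         measure_preserving mu (g i) & measure_preserving mu (gi i)]) /\
  (forall (x : X) (w : seq letter), w <> [::] -> reduced_word w ->
      word_in J w -> act_word (gen_step g gi) w x <> x).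

Definition orbit_rel_in (J : set nat) (g gi : nat -> X -> X) (x y : X) : Prop :=
  exists w, word_in J w /\ act_word (gen_step g gi) w x = y.

(* Main.v *)
(* Record the type of a point x: which words of bounded length agree at x, and the
   first digits of the points they reach, along the whole ball around x. There
   are finitely many types, and the measures m_i(s, t) of the points of type s
   sent by S_i to a point of type t are symmetric in s and t with marginals
   independent of i. These are rational linear relations, so the m_i(s, t) can be
   approximated by fractions c_i(s, t) / K satisfying them exactly, and a finite
   set with c_i(s, t) edges labelled i between the points of type s and those of
   type t carries involutions modelling the S_i edge by edge. A finite cover by
   a group generated by involutions without short relations destroys all short
   cycles without changing the proportions. A ball of the cover then is, like
   almost every ball of X, a tree determined by the type of its root.

   For a free action, every generator f is cut into involutions by the first
   coordinate at which x and f x differ, and these involutions form a treeing. *)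
Require Import Defs.
From HB Require Import structures.
From mathcomp Require Import all_boot all_order all_algebra all_fingroup.
From mathcomp Require Import all_classical all_reals all_analysis.
From mathcomp Require Import zify ring lra.
Set Implicit Arguments. Unset Strict Implicit. Unset Printing Implicit Defensive.
Import Order.TTheory GRing.Theory Num.Theory.
Local Open Scope classical_set_scope.
Local Open Scope ring_scope.

(** * Rational approximation of linear relations *)

Lemma rat_near (R : realType) (x e : R) : 0 < e -> exists q : rat, `|ratr q - x| < e.
Proof.
move=> e0; have /rat_in_itvoo[q] : x - e < x + e by lra.
by rewrite in_itv /= => /andP[? ?]; exists q; rewrite ltr_norml; lra.
Qed.

(* By induction on [s]: a value in the rational span of the previous ones is
   approximated by the same rational combination, any other value is free. *)
Lemma rat_approx_seq (R : realType) (I : eqType) (v : I -> R) (s : seq I) :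
  uniq s -> forall e : R, 0 < e -> exists q : I -> rat,
  (forall a : I -> rat, \sum_(i <- s) ratr (a i) * v i = 0 ->
     \sum_(i <- s) a i * q i = 0) /\
  (forall i, i \in s -> `|ratr (q i) - v i| < e).
Proof.
elim: s => [|i0 s IH] /=.
  by move=> _ e e0; exists (fun=> 0); split => // a _; rewrite big_nil.
move=> /andP[i0s us] e e0.
have ne i : i \in s -> (i == i0) = false.
  by move=> si; apply/negbTE; apply: contraNneq i0s => <-.
have ifne (a q : I -> rat) c :
    \sum_(i <- s) a i * (if i == i0 then c else q i) = \sum_(i <- s) a i * q i.
  by apply: eq_big_seq => i si; rewrite ne.
case: (pselect (exists b : I -> rat, v i0 = \sum_(i <- s) ratr (b i) * v i)).
- move=> [b vb].
  (* Accuracy [e / M] in the earlier values costs less than [e] in their combination by [b]; the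
     summand 1 makes this strict and keeps [e / M] at most [e]. *)
  pose M : R := 1 + \sum_(i <- s) `|ratr (b i) : R|.
  have M1 : 1 <= M by rewrite lerDl sumr_ge0.
  have M0 : 0 < M by lra.
  have [q [qr qc]] := IH us (e / M) (divr_gt0 e0 M0).
  exists (fun i => if i == i0 then \sum_(j <- s) b j * q j else q i); split.
  + move=> a; rewrite !big_cons eqxx vb => h.
    rewrite ifne.
    have -> : a i0 * (\sum_(j <- s) b j * q j) + \sum_(j <- s) a j * q j =
        \sum_(j <- s) (a i0 * b j + a j) * q j.
      by rewrite mulr_sumr -big_split; apply: eq_bigr => j _ /=; rewrite mulrDl mulrA.
    apply: qr; move: h; rewrite mulr_sumr -big_split /= => h; apply: etrans h.
    by apply: eq_bigr => i _; rewrite rmorphD rmorphM mulrDl -mulrA.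
  + move=> i; rewrite inE; case: eqVneq => [->|ii0] /= is_.
      rewrite vb rmorph_sum /= -sumrB.
      apply: (le_lt_trans (ler_norm_sum _ _ _)).
      apply: (@le_lt_trans _ _ (\sum_(i <- s) `|ratr (b i)| * (e / M))).
        rewrite !big_seq ler_sum// => j js.
        by rewrite rmorphM -mulrBr normrM ler_wpM2l // ltW // qc.
      rewrite -mulr_suml mulrA ltr_pdivrMr// mulrC ltr_pM2l// /M.
      by rewrite ltrDr.
    apply: (lt_le_trans (qc _ is_)).
    by rewrite ler_pdivrMr // ler_peMr // ltW.
- move=> nb; have [q [qr qc]] := IH us e e0.
  have [q0 hq0] := rat_near (v i0) e0.
  exists (fun i => if i == i0 then q0 else q i); split.
  + move=> a; rewrite !big_cons eqxx => h.
    rewrite ifne.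
    have [a0|a0] := eqVneq (a i0) 0.
      rewrite a0 mul0r add0r; apply: qr; move: h.
      by rewrite a0 rmorph0 mul0r add0r.
    (* A relation with a nonzero coefficient at [i0] would put [v i0] into the rational span of the
       other values. *)
    case: nb; exists (fun i => - a i / a i0).
    have a0' : ratr (a i0) != 0 :> R by rewrite fmorph_eq0.
    apply: (mulfI a0'); rewrite mulr_sumr.
    apply/eqP; rewrite -subr_eq0; apply/eqP; apply: etrans h; congr (_ + _).
    rewrite -sumrN; apply: eq_bigr => i _.
    rewrite rmorphM rmorphN fmorphV; field; exact: a0'.
  + by move=> i; rewrite inE; case: eqVneq => [->|ii0] //= is_; exact: qc.
Qed.

Lemma rat_common_denominator (I : finType) (q : I -> rat) :
  (forall i, 0 <= q i) ->
  exists (K : nat) (c : I -> nat), (0 < K)%N /\ forall i, q i = (c i)%:R / K%:R.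
Proof.
move=> q0.
pose K := (\prod_i `|denq (q i)|)%N.
have K0 : (0 < K)%N by apply: prodn_gt0 => i; rewrite absz_gt0 denq_neq0.
exists K; exists (fun i => `|numq (q i)| * (K %/ `|denq (q i)|))%N; split => // i.
have dK : (`|denq (q i)| %| K)%N by rewrite /K (bigD1 i) //= dvdn_mulr.
have Kn : (K%:R : rat) != 0 by rewrite pnatr_eq0 -lt0n.
apply: (mulIf Kn); rewrite divfK // natrM.
have -> : q i * K%:R = (q i * (`|denq (q i)|)%N%:R) * (K %/ `|denq (q i)|)%:R.
  by rewrite -mulrA -natrM mulnC divnK.
congr (_ * _).
have -> : ((`|denq (q i)|)%N%:R : rat) = (denq (q i))%:~R.
  by rewrite -[in RHS](gez0_abs (denq_ge0 (q i))).
have -> : ((`|numq (q i)|)%N%:R : rat) = (numq (q i))%:~R.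
  by rewrite -[in RHS](@gez0_abs (numq (q i))) // numq_ge0.
by rewrite -[X in X * _]divq_num_den divfK // intr_eq0 denq_neq0.
Qed.

(** An equality of partial sums is a relation with coefficients in {-1, 0, 1}, so a rational
    approximation can keep it, and clearing denominators makes it an equality of counts. Comparing
    [pred1 i] with [pred0] shows that zero values stay exactly zero. *)
Lemma nat_approx (R : realType) (I : finType) (v : I -> R) (e : R) :
  (forall i, 0 <= v i) -> 0 < e -> exists (K : nat) (c : I -> nat),
  [/\ (0 < K)%N,
      forall A B : pred I, \sum_(i | A i) v i = \sum_(i | B i) v i ->
        (\sum_(i | A i) c i = \sum_(i | B i) c i)%N &
      forall i, `|(c i)%:R / K%:R - v i| < e].
Proof.
move=> v0 e0.
(* An error below every nonzero value keeps the approximations of these values positive. *)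
pose d := \big[Num.min/e]_(i | v i != 0) v i.
have d0 : 0 < d.
  rewrite /d; elim/big_ind: _ => //.
    by move=> x y x0 y0; rewrite lt_min x0.
  by move=> i vi; rewrite lt_def vi v0.
have de : d <= e by rewrite /d; exact: bigmin_le_id.
have dv i : v i != 0 -> d <= v i by move=> vi; rewrite /d; exact: bigmin_le_cond.
have [q [qr qc]] := rat_approx_seq v (enum_uniq I) d0.
have rel (A B : pred I) : \sum_(i | A i) v i = \sum_(i | B i) v i ->
    \sum_(i | A i) q i = \sum_(i | B i) q i.
  move=> h; apply/eqP; rewrite -subr_eq0; apply/eqP.
  have E (F : numFieldType) (w : I -> F) :
      \sum_(i | A i) w i - \sum_(i | B i) w i =
      \sum_(i <- enum I) ((A i)%:R - (B i)%:R) * w i.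
    rewrite big_enum /= (big_mkcond A) (big_mkcond B) /= -sumrB.
    by apply: eq_bigr => i _; case: (A i); case: (B i);
      rewrite mulrBl ?mul1r ?mul0r.
  rewrite E; apply: qr.
  transitivity (\sum_(i | A i) v i - \sum_(i | B i) v i); last by rewrite h subrr.
  by rewrite E; apply: eq_bigr => i _; rewrite rmorphB !rmorph_nat.
have q0 i : 0 <= q i.
  have [vi|vi] := eqVneq (v i) 0.
    suff -> : q i = 0 by [].
    have := rel (pred1 i) pred0; rewrite !big_pred1_eq !big_pred0_eq; exact.
  have := qc i; rewrite mem_enum inE => /(_ isT).
  rewrite ltr_norml => /andP[h _]; rewrite -(ler0q R).
  by have := dv _ vi; lra.
have [K [c [K0 qK]]] := rat_common_denominator q0.
have Kn : (K%:R : rat) != 0 by rewrite pnatr_eq0 -lt0n.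
exists K, c; split => //.
- move=> A B /rel h; apply/eqP; rewrite -(eqr_nat rat) !natr_sum; apply/eqP.
  have E (C : pred I) : \sum_(i | C i) (c i)%:R = (\sum_(i | C i) q i) * K%:R.
    by rewrite mulr_suml; apply: eq_bigr => i _; rewrite qK divfK.
  by rewrite !E h.
- move=> i; apply: lt_le_trans de; have := qc i.
  rewrite mem_enum inE => /(_ isT); rewrite qK.
  by rewrite rmorphM fmorphV !rmorph_nat.
Qed.

(** * Finite models of the one-step statistics *)

(** Points of corresponding fibers are paired by their ranks in the enumerations. *)
Lemma fiber_bijection (T Y Z : finType) (t : Y -> T) (u : Z -> T) :
  (forall s, #|[pred y | t y == s]| = #|[pred z | u z == s]|) ->
  exists2 h : Y -> Z, bijective h & forall y, u (h y) = t y.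
Proof.
move=> card_fiber.
have card_YZ : #|Y| = #|Z|.
  rewrite -!sum1_card (partition_big t xpredT) //= (partition_big u xpredT) //=.
  by apply: eq_bigr => s _; rewrite !sum1_card card_fiber.
have [Y0|/card_gt0P[y0 _]] := posnP #|Y|.
  pose h (y : Y) : Z :=
    False_rect Z (Bool.diff_false_true (etrans (esym (card0_eq Y0 y)) erefl)).
  exists h; last by move=> y; have := card0_eq Y0 y.
  by apply: inj_card_bij; [move=> y; have := card0_eq Y0 y|rewrite card_YZ].
have [z0 _] : exists z0 : Z, z0 \in Z.
  by apply/card_gt0P; rewrite -card_YZ; apply/card_gt0P; exists y0.
pose fY s := enum [pred y | t y == s]; pose fZ s := enum [pred z | u z == s].
have sz s : size (fY s) = size (fZ s) by rewrite -!cardE card_fiber.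
pose h y := nth z0 (fZ (t y)) (index y (fY (t y))).
have idx y : (index y (fY (t y)) < size (fZ (t y)))%N.
  by rewrite -sz index_mem mem_enum inE.
have uh y : u (h y) = t y.
  by have := mem_nth z0 (idx y); rewrite mem_enum inE => /eqP.
exists h => //; apply: inj_card_bij; last by rewrite card_YZ.
move=> y y' hyy; have tt : t y = t y' by rewrite -!uh hyy.
have := idx y; have := idx y'; move: hyy; rewrite /h tt => /eqP + i' i.
rewrite nth_uniq ?enum_uniq // => /eqP /(congr1 (nth y0 (fY (t y')))).
by rewrite !nth_index // mem_enum inE ?tt.
Qed.

(* The model set consists of [c s s'] edges over each ordered pair, each cut
   into two half-edges; the involution flips the half-edges, so it has no fixed
   point even over the diagonal pairs [(s, s)]. *)
Lemma matching_involution (T Y : finType) (t : Y -> T) (c : T -> T -> nat) :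
  (forall s s', c s s' = c s' s) ->
  (forall s, #|[pred y | t y == s]| = (\sum_s' c s s').*2) ->
  exists f : Y -> Y, [/\ involutive f, forall y, f y != y &
    forall y, (0 < c (t y) (t (f y)))%N].
Proof.
move=> csym card_fiber.
pose Zf (p : T * T) : finType := ('I_(c p.1 p.2) * bool)%type.
pose Z : finType := {p : T * T & Zf p}.
pose u (z : Z) : T := (tag z).1.
pose swap (z : Z) : Z :=
  let: existT p x := z in
  existT Zf (p.2, p.1) (cast_ord (csym p.1 p.2) x.1, ~~ x.2).
have swapK : involutive swap.
  move=> [[s s'] [j b]] /=; congr (existT _ _ _).
  by congr (_, _); [apply: val_inj|rewrite /= negbK].
have swapN z : swap z != z.
  apply/eqP => /(congr1 (fun z : Z => (tagged z).2)) /=.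
  by case: z => [p [j []]].
have [|h hb uh] := @fiber_bijection T Y Z t u.
  move=> s; rewrite card_fiber -sum1_card.
  transitivity (\sum_(p : T * T | p.1 == s) \sum_(x : Zf p) 1)%N; last first.
    rewrite (sig_big_dep (fun p : T * T => p.1 == s) (fun _ => xpredT) (fun _ _ => 1%N)) /=.
    by apply: eq_bigl => z; rewrite andbT.
  under [RHS]eq_bigr do rewrite sum1_card card_prod card_ord card_bool muln2.
  transitivity (\sum_(a | a == s) \sum_b (c a b).*2)%N; last first.
    by rewrite pair_big_dep; apply: eq_bigl => p; rewrite andbT.
  by rewrite big_pred1_eq -!muln2 big_distrl /=; apply: eq_bigr => i _; rewrite muln2.
case: (hb) => g hK gK.
exists (fun y => g (swap (h y))); split.
- by move=> y; rewrite gK swapK hK.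
- by move=> y; apply: contra (swapN (h y)) => /eqP E; apply/eqP; rewrite -{2}E gK.
- move=> y; rewrite -!uh gK; case: (h y) => [[s s'] [j b]] /=.
  by apply: leq_ltn_trans (ltn_ord j).
Qed.

(** * Masses of events seen by a finite-valued map *)

Definition fiber_measurable (T : Type) (tau : X -> T) : Prop :=
  forall s, measurable [set x | tau x = s].

Section ProbabilityOnX.
Variables (R : realType) (mu : {measure set X -> \bar R}).
Hypothesis mu1 : mu setT = 1%:E.

Lemma mass_fin_num (A : set X) : measurable A -> mu A \is a fin_num.
Proof.
move=> mA; rewrite ge0_fin_numE //; apply: (@le_lt_trans _ _ (mu setT)).
  by apply: le_measure; rewrite ?inE.
by rewrite mu1 ltry.
Qed.

Lemma measurable_finite_fibers (T : finType) (tau : X -> T) (Q : pred T) :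
  fiber_measurable tau -> measurable [set x | Q (tau x)].
Proof.
move=> mtau.
rewrite (_ : [set x | Q (tau x)] = \bigcup_(s in [set s | Q s]) [set x | tau x = s]).
  by apply: fin_bigcup_measurable => // s _; exact: mtau.
by apply/seteqP; split=> [x Qx|x [s Qs /= ->]] //; exists (tau x).
Qed.

Lemma mass_finite_fibers (T : finType) (tau : X -> T) (Q : pred T) :
  fiber_measurable tau ->
  fine (mu [set x | Q (tau x)]) = \sum_(s | Q s) fine (mu [set x | tau x = s]).
Proof.
move=> mtau; rewrite -big_enum /=.
have -> : [set x | Q (tau x)] = [set x | tau x \in enum Q].
  by apply/seteqP; split=> x /=; rewrite mem_enum.
elim: (enum Q) (enum_uniq Q) => [_|s l IH /= /andP[sl ul]].
  rewrite big_nil (_ : [set x | _] = set0) ?measure0 //.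
  by apply/seteqP; split=> x //=.
rewrite big_cons -(IH ul).
have ml : measurable [set x | tau x \in l].
  exact: (@measurable_finite_fibers _ tau (mem l)).
rewrite -fineD ?mass_fin_num // -measureU //.
  congr (fine (mu _)); apply/seteqP; split=> x /=; rewrite inE.
    by case/predU1P; [left|right].
  by case=> [->|->]; rewrite ?eqxx ?orbT.
by apply/seteqP; split=> x //= [->]; rewrite (negbTE sl).
Qed.

End ProbabilityOnX.

Lemma ratio_close (R : realFieldType) (a a' b d : R) :
  0 <= a' -> a' <= b -> d <= 1/2 -> `|a' - a| <= d -> `|b - 1| <= d ->
  `|a' / b - a| <= 2 * d.
Proof.
move=> a'0 a'b d2 ha hb.
have b0 : 0 < b by move: hb; rewrite ler_norml; lra.
have -> : a' / b - a = (a' / b) * (1 - b) + (a' - a) by field; lra.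
apply: (le_trans (ler_normD _ _)); rewrite normrM; rewrite distrC in hb.
have q1 : `|a' / b| <= 1.
  by rewrite ger0_norm ?divr_ge0 ?(ltW b0) // ler_pdivrMr // mul1r.
have := ler_wpM2r (normr_ge0 (1 - b)) q1; rewrite mul1r.
by lra.
Qed.

Lemma card_tag_fiber (T : finType) (C : T -> nat) (Q : pred T) :
  #|[pred y : {s : T & 'I_(C s)} | Q (tag y)]| = (\sum_(s | Q s) C s)%N.
Proof.
rewrite -sum1_card.
transitivity (\sum_(s | Q s) \sum_(j : 'I_(C s)) 1)%N.
  rewrite (sig_big_dep Q (fun _ => xpredT) (fun _ _ => 1%N)) /=.
  by apply: eq_bigl => z; rewrite andbT.
by apply: eq_bigr => s _; rewrite sum1_card card_ord.
Qed.

(** Stated for a commutative monoid because it slices both sums of real masses and sums of natural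
    counts. *)
Lemma big_slice (A : Type) (idx : A) (op : Monoid.com_law idx) (I T : finType)
    (i : I) (Q : pred T) (c : I * (T * T) -> A) :
  \big[op/idx]_(k | (k.1 == i) && Q k.2.1) c k =
  \big[op/idx]_(s | Q s) \big[op/idx]_s' c (i, (s, s')).
Proof.
transitivity (\big[op/idx]_(j | j == i) \big[op/idx]_(p : T * T | Q p.1) c (j, p)).
  by rewrite pair_big_dep; apply: eq_bigr => -[].
rewrite big_pred1_eq pair_big_dep; apply: eq_big => [p|[]] //=.
by rewrite andbT.
Qed.

(** Symmetry of the masses [v], independence of their marginals from [i], and vanishing are all
    equalities of partial sums, so [nat_approx] keeps them exactly. The counts then admit a matching
    for each [i]. *)
Lemma finite_model (R : realType) (mu : {measure set X -> \bar R})
    (X0 : set X) (S : nat -> X -> X) (T : finType) (tau : X -> T)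
    (F : nat -> pred T) (N : nat) (eps : R) :
  mu setT = 1%:E ->
  (forall A, measurable A -> A `&` X0 = set0 -> mu A = 0%E) ->
  (forall i, borel_mp_involution mu (S i)) ->
  fiber_measurable tau ->
  (forall i x, (i <= N)%N -> S i x = x <-> F i (tau x)) ->
  0 < eps ->
  exists (Y : finType) (t : Y -> T) (sigma : nat -> Y -> Y),
  [/\ (0 < #|Y|)%N,
      forall i, involutive (sigma i),
      forall i y, (i <= N)%N -> exists x, [/\ X0 x, tau x = t y,
        tau (S i x) = t (sigma i y) & (S i x = x <-> sigma i y = y)] &
      forall Q : pred T,
        `|#|[pred y | Q (t y)]|%:R / #|Y|%:R - fine (mu [set x | Q (tau x)])|
          <= eps].
Proof.
move=> mu1 X0full HS mtau HF eps0.
pose tau2 (i : nat) (x : X) := (tau x, tau (S i x)).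
have mtau2 i : fiber_measurable (tau2 i).
  move=> [s s']; have [mS _ _] := HS i.
  rewrite (_ : [set x | _] = [set x | tau x = s] `&` (S i @^-1` [set x | tau x = s'])).
    by apply: measurableI; [exact: mtau|rewrite -[X in measurable X]setTI; exact: mS].
  by apply/seteqP; split=> x; rewrite /tau2 /= => -[-> ->].
pose v (k : 'I_N.+1 * (T * T)) := fine (mu [set x | tau2 k.1 x = k.2]).
have v0 k : 0 <= v k by rewrite fine_ge0.
have vsym (i : 'I_N.+1) s s' : v (i, (s, s')) = v (i, (s', s)).
  have [mS Sinv Smp] := HS i.
  rewrite /v /= -[in RHS]Smp; last exact: mtau2.
  congr (fine (mu _)); apply/seteqP; split=> x /=; rewrite /tau2 Sinv.
    by case=> -> ->.
  by case=> -> ->.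
have vmarg (i : 'I_N.+1) (Q : pred T) :
    \sum_(k : 'I_N.+1 * (T * T) | (k.1 == i) && Q k.2.1) v k =
    fine (mu [set x | Q (tau x)]).
  rewrite (mass_finite_fibers mu1 (fun p : T * T => Q p.1) (mtau2 i)).
  rewrite big_slice pair_big_dep; apply: eq_big => [p|[]] //=.
  by rewrite andbT.
pose n2 : R := (#|{: T * T}|)%:R.
have n20 : 0 <= n2 by rewrite ler0n.
(* One error [e1] for each pair of types adds up to at most [del], which [ratio_close] needs below
   1/2 and doubles into at most [eps]. *)
pose e1 : R := Num.min eps 1 / (2 * (n2 + 1)).
have m0 : 0 < Num.min eps 1 by rewrite lt_min eps0 ltr01.
have e10 : 0 < e1 by rewrite divr_gt0 //; lra.
pose del : R := Num.min eps 1 / 2.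
have e1d : n2 * e1 <= del.
  have <- : (n2 + 1) * e1 = del.
    by rewrite /e1 /del invfM mulrC -!mulrA mulVf ?mulr1 // gt_eqF // ltr_wpDl.
  by rewrite ler_wpM2r ?(ltW e10) // lerDl.
have del2 : del <= 1 / 2 by rewrite /del ler_wpM2r // ge_min lexx orbT.
have deleps : 2 * del <= eps by rewrite /del mulrC divfK // ge_min lexx.
have [K [c [K0 crel cc]]] := nat_approx v0 e10.
have csym (i : 'I_N.+1) s s' : c (i, (s, s')) = c (i, (s', s)).
  have := crel (pred1 (i, (s, s'))) (pred1 (i, (s', s))).
  by rewrite !big_pred1_eq; apply; exact: vsym.
pose C s := (\sum_s' c (ord0, (s, s')))%N.
have cmarg (i : 'I_N.+1) s : (\sum_s' c (i, (s, s')))%N = C s.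
  have E (j : 'I_N.+1) : (\sum_s' c (j, (s, s')))%N =
      (\sum_(k : 'I_N.+1 * (T * T) | (k.1 == j) && (k.2.1 == s)) c k)%N.
    by rewrite (big_slice _ j (pred1 s)) big_pred1_eq.
  rewrite /C !E; apply: crel.
  by rewrite (vmarg i (pred1 s)) (vmarg ord0 (pred1 s)).
(* A pair of mass zero has count zero, so a positive count is witnessed by a point of [X0]. *)
have real (i : 'I_N.+1) s s' : (0 < c (i, (s, s')))%N ->
    exists x, [/\ X0 x, tau x = s & tau (S i x) = s'].
  move=> cpos; apply: contrapT => nx.
  suff : c (i, (s, s')) = 0%N by move=> c0; rewrite c0 in cpos.
  have := crel (pred1 (i, (s, s'))) pred0.
  rewrite !big_pred1_eq !big_pred0_eq; apply.
  rewrite /v X0full ?fine0 //; first exact: mtau2.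
  apply/seteqP; split=> x //= [[h1 h2] h3]; apply: nx.
  by exists x; split.
(* Each unit of count is cut into two half-edges, hence the doubling here and the denominator
   [2 * K] below. *)
pose Y : finType := {s : T & 'I_((C s).*2)}.
pose t (y : Y) : T := tag y.
have cardQ (Q : pred T) : #|[pred y : Y | Q (t y)]| = (\sum_(s | Q s) (C s).*2)%N.
  exact: (card_tag_fiber (fun s => (C s).*2)).
have /choice[f Hf] (i : 'I_N.+1) : exists f : Y -> Y, [/\ involutive f,
    forall y, f y != y & forall y, (0 < c (i, (t y, t (f y))))%N].
  apply: (@matching_involution _ _ t (fun s s' => c (i, (s, s')))).
    exact: csym.
  move=> s; rewrite (cardQ (pred1 s)) big_pred1_eq cmarg //.
(* The matching [f] has no fixed point, so points whose type satisfies [F i] are frozen by hand. *)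
pose sigma (i : nat) (y : Y) : Y :=
  if (i <= N)%N && ~~ F i (t y) then f (inord i) y else y.
have inordN i : (i <= N)%N -> (inord i : 'I_N.+1) = i :> nat.
  by move=> iN; rewrite inordK.
exists Y, t, sigma.
have dist (Q : pred T) :
    `|(#|[pred y : Y | Q (t y)]|)%:R / (2 * K%:R) - fine (mu [set x | Q (tau x)])|
    <= del.
  rewrite -(vmarg ord0 Q) cardQ.
  have -> : (\sum_(s | Q s) (C s).*2)%N =
      ((\sum_(k : 'I_N.+1 * (T * T) | (k.1 == ord0) && Q k.2.1) c k) * 2)%N.
    by rewrite big_slice big_distrl; apply: eq_bigr => s _; rewrite /= muln2.
  have K0' : K%:R != 0 :> R by rewrite pnatr_eq0 -lt0n.
  rewrite natrM [2 * _]mulrC invfM mulrACA mulfV ?pnatr_eq0 // mulr1.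
  rewrite natr_sum mulr_suml -sumrB.
  apply: (le_trans (ler_norm_sum _ _ _)); apply: le_trans e1d.
  rewrite big_slice; apply: (@le_trans _ _ (\sum_(s : T) \sum_(s' : T) e1)).
    rewrite [leLHS]big_mkcond /=; apply: ler_sum => s _.
    case: ifP => _; first by apply: ler_sum => s' _; exact: ltW.
    by apply: sumr_ge0 => s' _; exact: ltW.
  by rewrite !sumr_const -mulrnA -mulr_natl /n2 card_prod.
have K2 : 0 < 2 * K%:R :> R by rewrite mulr_gt0 // ltr0n.
have distT : `|(#|Y|)%:R / (2 * K%:R) - 1| <= del.
  have := dist predT; rewrite (_ : [set x : X | _] = setT) ?mu1 //.
  by apply/seteqP; split.
have Y0 : (0 < #|Y|)%N.
  rewrite lt0n; apply/negP => /eqP Y0; move: distT.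
  by rewrite Y0 mul0r sub0r normrN1; lra.
split=> //.
- move=> i y; rewrite /sigma.
  have [/andP[iN nF]|/negbTE nc] := boolP ((i <= N)%N && ~~ F i (t y)); last first.
    by rewrite !nc.
  have [finv _ fpos] := Hf (inord i).
  have [x [_ tx tSx]] := real _ _ _ (fpos y); rewrite inordN // in tSx.
  have [_ Sinv _] := HS i.
  (* If [F i] held at the other end of the edge, [S i] would fix [S i x], hence also [x]. *)
  rewrite iN /= ifT ?finv //; apply: contra nF.
  rewrite -tSx -tx => /(HF _ _ iN); rewrite Sinv => E.
  by apply/(HF _ _ iN).
- move=> i y iN; rewrite /sigma iN /=.
  have [finv fne fpos] := Hf (inord i).
  have [x [Xx tx tSx]] := real _ _ _ (fpos y); rewrite inordN // in tSx.
  exists x; case: ifP => Fy; split=> //.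
  + split=> E; last by have := fne y; rewrite E eqxx.
    by move: Fy; rewrite -tx; have /(HF _ _ iN) -> := E.
  + by have /(HF _ _ iN) -> : F i (tau x) by rewrite tx; move/negbFE: Fy.
  + by split=> // _; apply/(HF _ _ iN); rewrite tx; move/negbFE: Fy.
- move=> Q; apply: le_trans deleps.
  have -> : (#|[pred y | Q (t y)]|)%:R / (#|Y|)%:R =
      (#|[pred y | Q (t y)]|)%:R / (2 * K%:R) / ((#|Y|)%:R / (2 * K%:R)) :> R.
    have Yn : #|Y|%:R != 0 :> R by rewrite pnatr_eq0 -lt0n.
    have Kn : K%:R != 0 :> R by rewrite pnatr_eq0 -lt0n.
    by field; rewrite Kn Yn.
  apply: ratio_close => //.
  by rewrite ler_wpM2r ?invr_ge0 ?(ltW K2) // ler_nat max_card.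
Qed.

(** * Walks and finite covers of large girth *)

Section LabelledWalks.
Variables (A : Type) (S : nat -> A -> A).

Definition run (x : A) (w : seq nat) : A := foldl (fun z i => S i z) x w.

Definition nonlazy (x : A) (w : seq nat) : Prop :=
  forall u i v, w = u ++ i :: v -> S i (run x u) <> run x u.

(** A girth bound at [x]: a walk that never pauses and never repeats a letter at once is one without
    backtracking. *)
Definition no_closed_walk (L N : nat) (x : A) : Prop :=
  forall w, all (ltn^~ N) w -> (0 < size w <= L)%N -> nonlazy x w ->
    (forall u i v, w <> u ++ [:: i, i & v]) -> run x w <> x.

Lemma run_cat x u v : run x (u ++ v) = run (run x u) v.
Proof. exact: foldl_cat. Qed.

Hypothesis SK : forall i, involutive (S i).

Lemma run_revK w : cancel (run^~ w) (run^~ (rev w)).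
Proof.
elim: w => [|i w IH] x //=.
by rewrite rev_cons -cats1 run_cat /= IH SK.
Qed.

Lemma run_eq x u v : run x u = run x v <-> run x (u ++ rev v) = x.
Proof.
rewrite run_cat; split=> [->|E]; first exact: run_revK.
by have := run_revK (rev v) (run x u); rewrite /= E revK.
Qed.

Lemma run_skip_lazy x u i v :
  S i (run x u) = run x u -> run x (u ++ i :: v) = run x (u ++ v).
Proof. by rewrite !run_cat /= => ->. Qed.

Lemma run_cancel_double x u i v : run x (u ++ [:: i, i & v]) = run x (u ++ v).
Proof. by rewrite !run_cat /= SK. Qed.

End LabelledWalks.

(* Erasing lazy steps and backtrackings turns any closed word into the empty
   one when there are no short reduced closed walks, and these erasures are
   dictated by the laziness pattern alone. *)
Lemma closed_words_from_laziness (A B : Type) (S : nat -> A -> A)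
    (sigma : nat -> B -> B) (L N : nat) (x : A) (y : B) :
  (forall i, involutive (S i)) -> (forall i, involutive (sigma i)) ->
  (forall w i, all (ltn^~ N) w -> (i < N)%N -> (size w < L)%N ->
    S i (run S x w) = run S x w <-> sigma i (run sigma y w) = run sigma y w) ->
  no_closed_walk S L N x -> no_closed_walk sigma L N y ->
  forall w, all (ltn^~ N) w -> (size w <= L)%N ->
    run S x w = x <-> run sigma y w = y.
Proof.
move=> SK sK lazyE tx ty w; have [n] := ubnP (size w).
elim: n w => // n IH w wn wN wL.
case: (pselect (exists u i v, w = u ++ i :: v /\ S i (run S x u) = run S x u)).
  move=> [u [i [v [E h]]]]; subst w.
  move: wN wn wL; rewrite all_cat size_cat /= => /and3P[uN iN vN] wn wL.
  have h' : sigma i (run sigma y u) = run sigma y u by apply/lazyE => //; lia.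
  rewrite !run_skip_lazy //; apply: IH; rewrite ?size_cat ?all_cat ?uN //; lia.
move=> nl.
case: (pselect (exists u i v, w = u ++ [:: i, i & v])).
  move=> [u [i [v E]]]; subst w.
  move: wN wn wL; rewrite all_cat size_cat /= => /and4P[uN iN _ vN] wn wL.
  rewrite !run_cancel_double //; apply: IH; rewrite ?size_cat ?all_cat ?uN //; lia.
move=> nd.
case: w wn wN wL nl nd => [//|a w'] wn wN wL nl nd.
have nd' u i v : a :: w' <> u ++ [:: i, i & v].
  by move=> E; apply: nd; exists u, i, v.
have nlx : nonlazy S x (a :: w').
  by move=> u i v E h; apply: nl; exists u, i, v.
have nly : nonlazy sigma y (a :: w').
  move=> u i v E h; apply: (nlx _ _ _ E).
  move: wN wL; rewrite E all_cat size_cat /= => /and3P[uN iN vN] wL.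
  by apply/lazyE => //; lia.
split=> h; exfalso.
- by apply: (tx (a :: w')).
- by apply: (ty (a :: w')).
Qed.

(* Left multiplication by the generator [i] on the ball of radius [L] in the
   Cayley tree of the free product of copies of Z/2, truncated to the identity
   where it would leave the ball. *)
Definition tree_flip (L N : nat) (i : 'I_N) (w : seq 'I_N) : seq 'I_N :=
  if ~~ sorted (fun a b => a != b) w then w else
  if w is a :: w' then
    if a == i then w' else if (size w < L)%N then i :: w else w
  else if (0 < L)%N then [:: i] else w.

Lemma tree_flip_size L N (i : 'I_N) w :
  (size w <= L)%N -> (size (tree_flip L i w) <= L)%N.
Proof.
rewrite /tree_flip; case: ifP => // _; case: w => [|a w] /= wL.
  by case: ifP.
by case: ifP => _; [exact: ltnW|case: ifP].
Qed.

Lemma tree_flipK L N (i : 'I_N) w :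
  (size w <= L)%N -> tree_flip L i (tree_flip L i w) = w.
Proof.
move=> szw; rewrite {2}/tree_flip; case: (boolP (sorted _ w)) => [sw|nsw] /=; last first.
  by rewrite /tree_flip nsw.
case: w sw szw => [|a w] sw szw.
  by case: ifP => L0; rewrite /tree_flip /= ?eqxx ?L0.
case: eqVneq => [E|ai].
  subst a; rewrite /tree_flip (path_sorted sw) /=.
  case: w sw szw => [|b w] /=; first by move=> _ ->.
  by move=> /andP[ib sw] ->; rewrite eq_sym (negbTE ib).
case: ifP => wL.
  by move: sw; rewrite /tree_flip /= (eq_sym i) ai => ->; rewrite /= eqxx.
by move: sw wL; rewrite /tree_flip /= => -> /= ->; rewrite (negbTE ai).
Qed.

Lemma ordinal_word N (w : seq nat) :
  all (ltn^~ N) w -> exists ws : seq 'I_N, w = map val ws.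
Proof.
elim: w => [|i w IH] /=; first by exists [::].
by move=> /andP[iN /IH[ws ->]]; exists (Ordinal iN :: ws).
Qed.

Lemma all_ordinal_word N (ws : seq 'I_N) : all (ltn^~ N) (map val ws).
Proof. by apply/allP => i /mapP[j _ ->]; exact: ltn_ord. Qed.

Lemma sorted_of_no_double (T : eqType) (w : seq T) :
  (forall u i v, w <> u ++ [:: i, i & v]) -> sorted (fun a b => a != b) w.
Proof.
elim: w => [//|a w IH] nd; case: w IH nd => [//|b w] IH nd /=.
apply/andP; split; first by apply/eqP => E; apply: (nd [::] b w); rewrite E.
by apply: IH => u i v E; apply: (nd (a :: u) i v); rewrite E.
Qed.

(** Each letter differs from the previous one and the length stays within [L], so every flip moves
    one step away from the center and adds its letter in front. *)
Lemma foldl_tree_flip L N (w : seq 'I_N) :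
  sorted (fun a b => a != b) w -> (size w <= L)%N ->
  foldl (fun z j => tree_flip L j z) [::] w = rev w.
Proof.
elim/last_ind: w => [//|w j IH] sw szw.
have sw' : sorted (fun a b => a != b) w.
  by move: sw; rewrite -cats1 => /cat_sorted2[].
rewrite size_rcons in szw.
rewrite foldl_rcons IH // ?(ltnW szw) // rev_rcons /tree_flip.
rewrite (_ : sorted _ (rev w)); last first.
  by rewrite rev_sorted; apply: sub_sorted sw' => a b; rewrite eq_sym.
case: (lastP w) sw szw => [|w' a] sw szw /=; first by rewrite szw.
rewrite rev_rcons /= ifN; last first.
  move: sw; rewrite -!cats1 -catA /= => /cat_sorted2[_] /=.
  by rewrite andbT.
by move: szw; rewrite size_rcons size_rev => ->.
Qed.

(** [H] is the symmetric group of the truncated tree. A closed reduced word would act as the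
    identity on the tree, whereas it carries the empty word to a nonempty one. *)
Lemma finite_girth (L N : nat) :
  exists (H : finType) (eta : nat -> H -> H),
  [/\ (0 < #|H|)%N, forall i, involutive (eta i) &
    forall w h, all (ltn^~ N) w -> (0 < size w <= L)%N ->
      (forall u i v, w <> u ++ [:: i, i & v]) -> run eta h w <> h].
Proof.
pose V : finType := L.-bseq 'I_N.
pose flip (j : 'I_N) (v : V) : V := Bseq (tree_flip_size j (size_bseq v)).
have flipK j : involutive (flip j).
  by move=> v; apply: val_inj; rewrite /= tree_flipK // size_bseq.
pose pflip j : {perm V} := perm (inv_inj (flipK j)).
pose eta (i : nat) (h : {perm V}) : {perm V} :=
  if insub i is Some j then (h * pflip j)%g else h.
exists {perm V}, eta; split.
- by apply/card_gt0P; exists 1%g.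
- move=> i h; rewrite /eta; case: insub => // j; apply/permP => v.
  by rewrite !permM !permE flipK.
- move=> w h /ordinal_word[ws ->]; rewrite size_map => /andP[w0 wL] nd E.
  have sws : sorted (fun a b => a != b) ws.
    apply: sorted_of_no_double => u i v Ews.
    by apply: (nd (map val u) (val i) (map val v)); rewrite Ews map_cat.
  pose nilV : V := @Bseq L _ [::] (leq0n L).
  have evalE (u : seq 'I_N) (g : {perm V}) (v : V) :
      val (run eta g (map val u) v) =
      foldl (fun z j => tree_flip L j z) (val (g v)) u.
    elim: u g v => [//|j u IH] g v /=.
    by rewrite IH /eta valK permM permE.
  (* The chosen point is the one that [h] sends to the empty word. *)
  have := evalE ws h ((h^-1)%g nilV).
  rewrite E permKV foldl_tree_flip //= => /(congr1 size).
  by rewrite size_rev => /esym sz0; rewrite sz0 in w0.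
Qed.

(** In the product with [H] both coordinates are frozen where [sigma i] fixes the point, so laziness
    is the same above and below. Along a nonlazy walk the second coordinate follows [eta], which
    cannot close up early. *)
Lemma girth_cover (Y : finType) (sigma : nat -> Y -> Y) (L N : nat) :
  (forall i, involutive (sigma i)) ->
  exists (Z : finType) (pr : Z -> Y) (rho : nat -> Z -> Z),
  [/\ forall i, involutive (rho i),
      forall i z, pr (rho i z) = sigma i (pr z),
      forall i z, rho i z = z <-> sigma i (pr z) = pr z,
      forall z, no_closed_walk rho L N z &
      exists2 k, (0 < k)%N &
        forall P : pred Y, #|[pred z | P (pr z)]| = (#|[pred y | P y]| * k)%N].
Proof.
move=> sK; have [H [eta [H0 etaK etaN]]] := finite_girth L N.
pose rho i (z : Y * H) :=
  if sigma i z.1 == z.1 then z else (sigma i z.1, eta i z.2).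
exists (Y * H)%type, (fun z => z.1), rho; split.
- move=> i [y h]; rewrite /rho /=; case: (eqVneq (sigma i y) y) => [E|ne] /=.
    by rewrite E eqxx.
  by rewrite sK eq_sym (negbTE ne) etaK.
- by move=> i [y h]; rewrite /rho /=; case: eqVneq.
- move=> i [y h]; rewrite /rho /=; case: eqVneq => // ne.
  by split=> [[E _]|E]; rewrite E ?eqxx in ne *.
- have runE w z : nonlazy rho z w -> (run rho z w).2 = run eta z.2 w.
    elim: w z => [//|i w IH] [y h] nl /=.
    have E : rho i (y, h) = (sigma i y, eta i h).
      rewrite /rho /=; case: eqVneq => // E; case: (nl [::] i w erefl).
      by rewrite /= /rho /= E eqxx.
    rewrite E IH //= => u j v Ew; have := nl (i :: u) j v.
    by rewrite Ew /= E; exact.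
  move=> z w wN wL nl nd E; apply: (etaN w z.2 wN wL nd).
  by rewrite -runE // E.
- exists #|H| => // P.
  rewrite -cardX /=; apply: eq_card => -[y h].
  by rewrite !inE andbT.
Qed.

(** * Balls in the finite models *)

Section BallTransfer.
Variables (A B : Type) (S : nat -> bool -> A -> A) (sigma : nat -> bool -> B -> B).
Variables (labA : A -> nat -> bool) (labB : B -> nat -> bool).
Variables (r : nat) (x : A) (y : B).

(** Reducedness is dropped and length [r.+1] allowed below, since prolonging the word of a vertex by
    an edge may leave [in_W r] in either way. *)
Let small (n : nat) (w : seq letter) := all (fun l => (l.1 < r)%N) w && (size w <= n)%N.

Hypothesis same_eq : forall w w', small r.+1 w -> small r.+1 w' ->
  act_word S w x = act_word S w' x -> act_word sigma w y = act_word sigma w' y.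
Hypothesis same_eq' : forall w w', small r.+1 w -> small r.+1 w' ->
  act_word sigma w y = act_word sigma w' y -> act_word S w x = act_word S w' x.
Hypothesis same_lab : forall w j, small r w -> (j < r)%N ->
  labA (act_word S w x) j = labB (act_word sigma w y) j.

Lemma in_W_small w : Defs.in_W r w -> small r.+1 w.
Proof. by rewrite /small => /and3P[_ /leqW -> ->]. Qed.

(** The word reaching a vertex from [x] is read again from [y]. Here [same_eq] gives coverage and
    edges, [same_eq'] injectivity and missing edges. *)
Lemma ball_iso_transfer (a : Defs.rgraph r) :
  ball_iso S labA r x a -> ball_iso sigma labB r y a.
Proof.
move=> [f [finj fball froot flab fedge]].
have /choice[w Hw] (v : 'I_(rg_n a)) :
    exists w, Defs.in_W r w /\ act_word S w x = f v.
  by apply/fball; exists v.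
have ws v : small r.+1 (w v) by apply: in_W_small; case: (Hw v).
have ws' v i e : (i < r)%N -> small r.+1 ((i, e) :: w v).
  by case: (Hw v) => /and3P[_ h1 h2] _ ir; rewrite /small /= ir h2 ltnS.
have ballB z : ball_vertices sigma r y z <-> exists v, act_word sigma (w v) y = z.
  split=> [[u [uW <-]]|[v <-]]; last by exists (w v); split=> //; case: (Hw v).
  have [v fv] : exists v, f v = act_word S u x by apply/fball; exists u.
  exists v; apply: same_eq => //; first exact: in_W_small.
  by rewrite -fv; case: (Hw v).
exists (fun v => act_word sigma (w v) y); split=> //.
- move=> v v' /(same_eq' (ws v) (ws v')).
  by case: (Hw v) => _ ->; case: (Hw v') => _ -> /finj.
- rewrite -[RHS]/(act_word sigma [::] y); apply: same_eq => //.
  by case: (Hw (rg_root a)) => _ ->; rewrite froot.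
- move=> v j; have [/and3P[_ h1 h2] wv] := Hw v.
  by rewrite -same_lab ?wv ?flab // /small h1 h2.
- move=> v i e; have := fedge v i e; case: rg_edge => [u E|nb].
    apply: (@same_eq ((val i, e) :: w v) (w u)) => //; first exact: ws' (ltn_ord i).
    by case: (Hw v) (Hw u) => _ /= -> [_ ->].
  move=> [u [uW E]]; apply: nb; exists u; split=> //.
  have := @same_eq' u ((val i, e) :: w v) (in_W_small uW) (ws' _ _ _ (ltn_ord i)) E.
  by move=> ->; rewrite /=; case: (Hw v) => _ ->.
Qed.

End BallTransfer.

Lemma act_word_run (A : Type) (S : nat -> A -> A) (w : seq letter) (x : A) :
  act_word (fun i _ => S i) w x = run S x (rev (map fst w)).
Proof.
elim: w x => [//|l w IH] x /=.
by rewrite rev_cons -cats1 run_cat /= IH.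
Qed.

(** Serves between [X] and a model, and also between two points of [X], to see that balls depend on
    finitely many observations. *)
Lemma ball_iso_involutions (A B : Type) (S : nat -> A -> A) (sigma : nat -> B -> B)
    (labA : A -> nat -> bool) (labB : B -> nat -> bool) (r M N : nat) (x : A) (y : B) :
  (r <= N)%N -> (r < M)%N ->
  (forall u v, all (ltn^~ N) u -> all (ltn^~ N) v ->
    (size u <= M)%N -> (size v <= M)%N ->
    run S x u = run S x v <-> run sigma y u = run sigma y v) ->
  (forall w j, all (ltn^~ N) w -> (size w <= M)%N -> (j < N)%N ->
    labA (run S x w) j = labB (run sigma y w) j) ->
  forall a : Defs.rgraph r,
  ball_iso (fun i _ => S i) labA r x a -> ball_iso (fun i _ => sigma i) labB r y a.
Proof.
move=> rN rM eqE labE a.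
have sm w n : (n <= M)%N -> all (fun l : letter => (l.1 < r)%N) w && (size w <= n)%N ->
    all (ltn^~ N) (rev (map fst w)) /\ (size (rev (map fst w)) <= M)%N.
  move=> nM /andP[/allP h1 h2]; split; last first.
    by rewrite size_rev size_map (leq_trans h2).
  rewrite all_rev all_map; apply/allP => l /h1 /= lr; exact: leq_trans rN.
apply: ball_iso_transfer.
- move=> w w' /(sm _ _ rM)[? ?] /(sm _ _ rM)[? ?]; rewrite !act_word_run.
  by move=> /eqE; exact.
- move=> w w' /(sm _ _ rM)[? ?] /(sm _ _ rM)[? ?]; rewrite !act_word_run.
  by move=> /eqE; exact.
- move=> w j /(sm _ _ (ltnW rM))[? ?] jr; rewrite !act_word_run; apply: labE => //.
  exact: leq_trans rN.
Qed.

Section FiniteApproximation.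
Variables (R : realType) (mu : {measure set X -> \bar R}).
Hypothesis mu1 : mu setT = 1%:E.
Variables (X0 : set X) (S : nat -> X -> X).
Hypothesis X0full : forall A, measurable A -> A `&` X0 = set0 -> mu A = 0%E.
Hypothesis HS : forall i, borel_mp_involution mu (S i).

Lemma measurable_run w : measurable_fun setT (fun x : X => run S x w).
Proof.
elim/last_ind: w => [|w i IH]; first exact: measurable_id.
have [mS _ _] := HS i.
rewrite (_ : (fun x => _) = S i \o (fun x => run S x w)).
  exact: measurableT_comp.
by apply/funext => x; rewrite -cats1 run_cat.
Qed.

Lemma measurable_run_preimage w (A : set X) :
  measurable A -> measurable [set x | A (run S x w)].
Proof.
by move=> mA; rewrite -[X in measurable X]setTI; exact: measurable_run.
Qed.

Lemma fiber_measurable_ffun (I T : finType) (b : I -> X -> T) :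
  (forall i, fiber_measurable (b i)) ->
  fiber_measurable (fun x => [ffun i => b i x] : {ffun I -> T}).
Proof.
move=> mb s.
rewrite (_ : [set x | _] = \bigcap_(i in [set: I]) [set x | b i x = s i]).
  by apply: fin_bigcap_measurable => // i _; exact: mb.
apply/seteqP; split=> x /= E; first by move=> i _ /=; rewrite -E ffunE.
by apply/ffunP => i; rewrite ffunE; exact: E.
Qed.

(* The type of [x] used by [finite_model] is the family of all [b (S_w x)] with
   [w] of length at most [L]. A model in which each edge is locally realized then
   reproduces [b] along every walk of length at most [L], whence also the
   laziness pattern, and the girth of the model does the rest. *)
Lemma finite_approximation (T : finType) (b : X -> T) (F : nat -> pred T)
    (L N : nat) (eps : R) :
  fiber_measurable b ->
  (forall i x, (i <= N)%N -> S i x = x <-> F i (b x)) ->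
  (forall x, X0 x -> no_closed_walk S L N.+1 x) ->
  0 < eps ->
  exists (Y : finType) (beta : Y -> T) (sigma : nat -> Y -> Y),
  [/\ (0 < #|Y|)%N,
      forall i, involutive (sigma i),
      forall y, exists x, [/\ X0 x,
        (forall w, all (ltn^~ N.+1) w -> (size w <= L)%N ->
           b (run S x w) = beta (run sigma y w)) &
        (forall w, all (ltn^~ N.+1) w -> (size w <= L)%N ->
           run S x w = x <-> run sigma y w = y)] &
      forall Q : pred T,
        `|#|[pred y | Q (beta y)]|%:R / #|Y|%:R - fine (mu [set x | Q (b x)])|
          <= eps].
Proof.
move=> mb HF tree eps0.
pose W : finType := L.-bseq 'I_N.+1.
pose word (u : W) : seq nat := map val (val u).
pose nilW : W := @Bseq L _ [::] (leq0n L).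
pose tau (x : X) : {ffun W -> T} := [ffun u => b (run S x (word u))].
have mtau : fiber_measurable tau.
  by apply: fiber_measurable_ffun => u s; exact: (measurable_run_preimage (word u) (mb s)).
have tau_nil x : tau x nilW = b x by rewrite ffunE.
have wordE w : all (ltn^~ N.+1) w -> (size w <= L)%N -> exists u : W, word u = w.
  by move=> /ordinal_word[ws ->]; rewrite size_map => h; exists (Bseq h).
have [|Y [t [sigma [Y0 sK real prop]]]] :=
    @finite_model R mu X0 S _ tau (fun i s => F i (s nilW)) N eps
      mu1 X0full HS mtau _ eps0.
  by move=> i x iN; rewrite tau_nil; exact: HF.
have [Z [pr [rho [rK prE lazyE tree' [k k0 cardE]]]]] := girth_cover L N.+1 sK.
pose tz (z : Z) := t (pr z).
have real' i z : (i <= N)%N -> exists x, [/\ X0 x, tau x = tz z,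
    tau (S i x) = tz (rho i z) & (S i x = x <-> rho i z = z)].
  move=> /(real i (pr z)) [x [? ? tS E]]; exists x; split=> //.
    by rewrite /tz prE.
  by rewrite lazyE.
have transport x z w : X0 x -> tau x = tz z -> all (ltn^~ N.+1) w -> (size w <= L)%N ->
    b (run S x w) = tz (run rho z w) nilW.
  move=> _ tx wN wL.
  have agree (u : W) : tz z u = b (run S x (word u)) by rewrite -tx ffunE.
  (* Each step costs one unit of the radius [n] up to which [z'] predicts [b] around [x']. The edge
     at [z'] is realized by some [x''], which need not be [x'] but has the type of [z']. *)
  suff H n x' z' : (size w <= n <= L)%N ->
      (forall u : W, (size (word u) <= n)%N -> b (run S x' (word u)) = tz z' u) ->
      b (run S x' w) = tz (run rho z' w) nilW.
    by apply: (H L x z) => [|u _]; rewrite ?wL ?leqnn ?agree.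
  elim: w wN {wL} n x' z' => [_ n x' z' _ /(_ nilW) -> //|i w IH] /=.
  move=> /andP[iN wN] [//|n] x' z' /andP[wn nL] H.
  apply: (IH wN n) => [|u un]; first by rewrite -ltnS wn ltnW.
  have [x'' [_ tx'' tSx'' _]] := real' i z' iN.
  have [|/= |u' u'E] := wordE (i :: word u).
  - by rewrite /= iN all_ordinal_word.
  - by rewrite (leq_ltn_trans un).
  have := H u'; rewrite u'E /= ltnS => /(_ un) ->.
  by rewrite -tSx'' -tx'' !ffunE u'E.
exists Z, (fun z => tz z nilW), rho; split=> //.
- have := cardE predT; rewrite (_ : #|[pred z | predT (pr z)]| = #|Z|).
    by move=> ->; rewrite muln_gt0 k0 andbT.
  by apply: eq_card.
- move=> z; have [x [Xx tx _ _]] := real' 0%N z (leq0n N).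
  have bE w := @transport x z w Xx tx; exists x; split=> //.
  apply: closed_words_from_laziness => //.
  + by move=> i; case: (HS i).
  (* Laziness in [X] is read from [b] through [F], and laziness in the model from the point
     realizing the edge. *)
  + move=> w i wN iN wL; rewrite HF // bE ?(ltnW wL) //.
    have [x' [_ tx' _ <-]] := real' i (run rho z w) iN.
    by rewrite HF // -tx' tau_nil.
  + exact: tree.
- move=> Q; have := prop (fun s => Q (s nilW)).
  have Zc : #|Z| = (#|Y| * k)%N.
    by rewrite -(cardE predT); apply: eq_card.
  rewrite Zc (cardE (fun y => Q (t y nilW))) !natrM -mulf_div divff ?mulr1.
    congr (_ <= _); congr (`| _ - fine (mu _)|).
    by apply/seteqP; split=> x /=; rewrite tau_nil.
  by rewrite pnatr_eq0 -lt0n.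
Qed.

End FiniteApproximation.

(** * Treeings are sofic *)

Lemma nth_walk (S : nat -> X -> X) (d y : X) (l : seq nat) (j : nat) :
  (j <= size l)%N -> nth d (walk S y l) j = run S y (take j l).
Proof.
elim: l y j => [|i l IH] y [|j] //= jl.
exact: IH.
Qed.

Lemma orbit_run (S : nat -> X -> X) (x y : X) :
  orbit_rel (invol_step S) x y <-> exists w, run S x w = y.
Proof.
split=> [[w <-]|[w <-]].
  by exists (rev (map fst w)); rewrite -act_word_run.
exists (rev (map (fun i => (i, true)) w)).
rewrite /invol_step act_word_run map_rev revK -map_comp.
by congr run; rewrite map_id.
Qed.

(* A shortest reduced closed walk of the orbit has distinct vertices, since a
   repetition would cut out a shorter one. *)
Lemma cycle_of_closed_walk (S : nat -> X -> X) (x y : X) (l : seq nat) :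
  (exists w, run S x w = y) -> (0 < size l)%N -> run S y l = y ->
  (forall j, (j < size l)%N -> run S y (take j.+1 l) <> run S y (take j l)) ->
  (forall j, (j.+1 < size l)%N -> nth 0%N l j <> nth 0%N l j.+1) ->
  exists z l', orbit_rel (invol_step S) x z /\ is_cycle S z l'.
Proof.
have [n] := ubnP (size l); elim: n y l => // n IH y l ln [w wy] l0 ly nl nd.
case: (pselect (exists j j', (j < j' < size l)%N /\
    run S y (take j l) = run S y (take j' l))).
  move=> [j [j' [/andP[jj' j'l] E]]].
  pose l' := take (j' - j) (drop j l).
  have sl' : size l' = (j' - j)%N by rewrite size_take size_drop ltn_sub2r // (ltn_trans jj').
  have runE k : (k <= j' - j)%N ->
      run S (run S y (take j l)) (take k l') = run S y (take (j + k) l).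
    move=> kj; rewrite /l' take_takel // -run_cat take_drop (addnC k).
    by rewrite -(take_takel l (leq_addr k j)) cat_take_drop.
  apply: (IH (run S y (take j l)) l').
  - by rewrite sl'; lia.
  - by exists (w ++ take j l); rewrite run_cat wy.
  - by rewrite sl' subn_gt0.
  - by rewrite -[X in run _ _ X]take_size sl' runE // subnKC ?(ltnW jj').
  - move=> k; rewrite sl' => kj; rewrite !runE ?(ltnW kj) // addnS.
    by apply: nl; lia.
  - move=> k; rewrite sl' => kj.
    rewrite !nth_take ?(ltnW kj) // !nth_drop addnS; apply: nd; lia.
move=> dist; exists y, l; split; first by apply/orbit_run; exists w.
have vE j : (j <= size l)%N -> nth y (walk S y l) j = run S y (take j l).
  exact: nth_walk.
have distv j j' : (j < j' < size l)%N -> run S y (take j l) <> run S y (take j' l).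
  by move=> jj' E; apply: dist; exists j, j'.
split=> //.
- by rewrite vE // take_size.
- by move=> j jl; rewrite !vE ?(ltnW jl) //; exact: nl.
- move=> j j' jj'; rewrite !vE; [exact: distv|lia|lia].
- move=> j j' jj' [lE]; rewrite !vE; [|lia|lia|lia|lia].
  case=> [[E _]|[E E']]; first exact: (distv _ _ jj').
  (* An edge crossed back must join the first vertex to the last before closing, so distinct
     vertices force [j = 0] and [j' = 1]; its label would then be repeated at once. *)
  have [j'l|j'l] := ltnP j'.+1 (size l).
    by apply: (distv j j'.+1); first lia.
  have {}j'l : j'.+1 = size l by lia.
  move: E; rewrite j'l take_size ly => E.
  have [j0|j0] := posnP j; last by apply: (distv 0%N j); [lia|rewrite take0 E].
  subst j; have [j'1|j'1] := eqVneq j' 1%N.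
    by apply: (nd 0%N); [lia|rewrite lE j'1].
  by apply: (distv 1%N j'); first lia.
Qed.

Lemma no_closed_walk_of_no_cycle (S : nat -> X -> X) (L N : nat) (x : X) :
  (~ exists y l, orbit_rel (invol_step S) x y /\ is_cycle S y l) ->
  no_closed_walk S L N x.
Proof.
move=> nc w _ /andP[w0 _] nl nd E; apply: nc.
apply: (@cycle_of_closed_walk S x x w) => //; first by exists [::].
- move=> j jw; rewrite (take_nth 0%N) // -cats1 run_cat.
  by apply: (nl _ _ (drop j.+1 w)); rewrite -drop_nth // cat_take_drop.
- move=> j jw E'; apply: (nd (take j w) (nth 0%N w j) (drop j.+2 w)).
  by rewrite {2}E' -!drop_nth ?cat_take_drop // ltnW.
Qed.

(** * Measurable observations and ball statistics *)

Lemma measurable_coordinate (j : nat) (e : bool) : measurable [set x : X | x j = e].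
Proof.
apply: sub_sigma_algebra.
rewrite (_ : [set x | _] = @proj nat (fun=> bool) j @^-1` [set e]) //.
apply: open_comp; last exact: discrete_open.
by move=> x _; exact: proj_continuous.
Qed.

Lemma fiber_measurable_bool (P : X -> bool) :
  measurable [set x | P x] -> fiber_measurable P.
Proof.
move=> mP [] //; rewrite (_ : [set x | _] = ~` [set x | P x]).
  exact: measurableC.
by apply/seteqP; split=> x /=; case: (P x).
Qed.

Lemma measurable_eq_fun (f g : X -> X) :
  measurable_fun setT f -> measurable_fun setT g -> measurable [set x | f x = g x].
Proof.
move=> mf mg.
have mc (h : X -> X) j e : measurable_fun setT h -> measurable [set x | h x j = e].
  move=> mh; rewrite -[X in measurable X]setTI.
  exact: (mh measurableT _ (measurable_coordinate j e)).
rewrite (_ : [set x | _] = \bigcap_j \bigcup_(e in [set: bool])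
    ([set x | f x j = e] `&` [set x | g x j = e])).
  apply: bigcapT_measurable => j; apply: fin_bigcup_measurable => // e _.
  by apply: measurableI; exact: mc.
apply/seteqP; split=> x /= E.
  by move=> j _; exists (f x j) => //=; rewrite E.
by apply/funext => j; have [e _ [/= -> ->]] := E j I.
Qed.

(** Balls of radius at most [n] are determined by [b] in [X] and by [beta] in the model, so their
    statistics are the mass and the proportion of a set [Q] of observed values. One model serves all
    [r <= n] at once. *)
Lemma sofic_action_at_scale (R : realType) (mu : {measure set X -> \bar R})
    (S : nat -> X -> X) (n : nat) (eps : R) :
  mu setT = 1%:E -> (forall i, borel_mp_involution mu (S i)) ->
  treeing mu S -> 0 < eps ->
  exists (Y : finType) (lab : Y -> nat -> bool) (sigma : nat -> {perm Y}),
    (0 < #|Y|)%N /\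
    forall (r : nat) (a : Defs.rgraph r), (r <= n)%N ->
      p_X mu (invol_step S) a \is a fin_num /\
      `|p_fin R sigma lab a - fine (p_X mu (invol_step S) a)| <= eps.
Proof.
move=> mu1 HS tree eps0.
have SK i : involutive (S i) by case: (HS i).
pose X0 := [set x : X | ~ exists y l, orbit_rel (invol_step S) x y /\ is_cycle S y l].
(* [treeing] provides a measurable null set containing the complement of [X0]. *)
have X0full A : measurable A -> A `&` X0 = set0 -> mu A = 0%E.
  move=> mA AX0; case: tree => M [mM M0 sub].
  apply/eqP; rewrite eq_le measure_ge0 andbT -M0; apply: le_measure; rewrite ?inE //.
  move=> x Ax; apply: sub => /= nx.
  by suff : set0 x by []; rewrite -AX0; split.
(* Edges tested at the boundary of a ball of radius [n] use words of length [n.+1]. *)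
pose M := n.+1.
pose W : finType := M.-bseq 'I_M.
pose word (u : W) : seq nat := map val (val u).
pose nilW : W := @Bseq M _ [::] (leq0n M).
have wordE w : all (ltn^~ M) w -> (size w <= M)%N -> exists u : W, word u = w.
  by move=> /ordinal_word[ws ->]; rewrite size_map => h; exists (Bseq h).
pose obs (k : W * W + W * 'I_M) (x : X) : bool :=
  match k with
  | inl p => `[< run S x (word p.1) = run S x (word p.2) >]
  | inr p => run S x (word p.1) p.2
  end.
pose b (x : X) : {ffun W * W + W * 'I_M -> bool} := [ffun k => obs k x].
have mrun w : measurable_fun setT (fun x : X => run S x w) by exact: (measurable_run HS).
have mb : fiber_measurable b.
  apply: fiber_measurable_ffun => -[[u v]|[u j]]; apply: fiber_measurable_bool => /=.
    rewrite (_ : [set x | _] = [set x | run S x (word u) = run S x (word v)]).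
      exact: measurable_eq_fun.
    by apply/seteqP; split=> x /= /asboolP.
  rewrite -[X in measurable X]setTI.
  exact: (mrun (word u) measurableT _ (measurable_coordinate j true)).
have beq u v x : b x (inl (u, v)) <-> run S x (word u) = run S x (word v).
  by rewrite ffunE /=; split=> /asboolP.
have blab u j x : b x (inr (u, j)) = run S x (word u) j by rewrite ffunE.
pose gen (i : nat) : W := insubd nilW [:: inord i].
have word_gen i : (i <= n)%N -> word (gen i) = [:: i].
  by move=> ii; rewrite /word /gen val_insubd /= inordK.
(* [S i] fixes [x] when the word [[:: i]] and the empty word agree at [x], which [b] records. *)
pose F i (s : {ffun W * W + W * 'I_M -> bool}) := s (inl (gen i, nilW)).
have HF i x : (i <= n)%N -> S i x = x <-> F i (b x).
  by move=> ii; rewrite /F beq word_gen.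
(* Two walks of length at most [M] are compared through one closed word of length at most
   [M + M]. *)
have tree' x : X0 x -> no_closed_walk S (M + M) n.+1 x.
  exact: no_closed_walk_of_no_cycle.
have [Y [beta [sigma [Y0 sK loc prop]]]] :=
  finite_approximation mu1 X0full HS mb HF tree' eps0.
pose lab (y : Y) (j : nat) : bool := beta y (inr (nilW, inord j)).
pose psigma i : {perm Y} := perm (inv_inj (sK i)).
have pstepE : perm_step psigma = (fun i _ => sigma i).
  apply/funext => i; apply/funext => e; apply/funext => y; case: e; rewrite /perm_step.
    by rewrite permE.
  by apply: (@perm_inj _ (psigma i)); rewrite permKV permE sK.
exists Y, lab, psigma; split=> // r a rn.
pose ball x := ball_iso (invol_step S) (fun x : X => x : nat -> bool) r x a.
have ballX x x' : b x = b x' -> ball x -> ball x'.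
  move=> bb; apply: (@ball_iso_involutions _ _ S S _ _ r M M) => //; first exact: leqW.
    move=> u v uM vM /(wordE _ uM)[u' <-] /(wordE _ vM)[v' <-].
    by rewrite -!beq bb.
  move=> w j wM /(wordE _ wM)[w' <-] jM.
  by have := blab w' (Ordinal jM) x; rewrite bb blab.
pose Q s := `[< exists x, b x = s /\ ball x >].
have ballQ x : ball x <-> Q (b x).
  split=> [bx|/asboolP[x' [/ballX bb /bb]] //].
  by apply/asboolP; exists x.
have ballY y : ball_iso (perm_step psigma) lab r y a <-> Q (beta y).
  have [x [_ bE eqE]] := loc y.
  have bx : b x = beta y by apply: (bE [::]).
  have eq2 u v : all (ltn^~ M) u -> all (ltn^~ M) v -> (size u <= M)%N ->
      (size v <= M)%N -> run S x u = run S x v <-> run sigma y u = run sigma y v.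
    move=> uM vM su sv; rewrite !run_eq //; apply: eqE.
      by rewrite all_cat all_rev uM vM.
    by rewrite size_cat size_rev leq_add.
  have lab2 w j : all (ltn^~ M) w -> (size w <= M)%N -> (j < M)%N ->
      run S x w j = lab (run sigma y w) j.
    move=> wM sw jM; rewrite /lab -bE // ?blab ?inordK //.
    exact: (leq_trans sw (leq_addr _ _)).
  rewrite -bx -ballQ pstepE; split.
    apply: (@ball_iso_involutions _ _ sigma S _ _ r M M) => //; first exact: leqW.
      by move=> u v ? ? ? ?; rewrite eq2.
    by move=> w j ? ? ?; rewrite lab2.
  by apply: (@ball_iso_involutions _ _ S sigma _ _ r M M) => //; exact: leqW.
have pXE : p_X mu (invol_step S) a = mu [set x | Q (b x)].
  by rewrite /p_X; congr (mu _); apply/seteqP; split=> x /= /ballQ.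
split; first by rewrite pXE mass_fin_num //; exact: measurable_finite_fibers.
have := prop Q; rewrite pXE; congr (`| _%:R / _ - _| <= _).
apply: eq_card => y; rewrite !inE; apply/idP/idP.
  by move=> /ballY Qy; apply/asboolP/asboolP.
by move=> /asboolP/asboolP/ballY.
Qed.

(** The [n]-th model has error at most [1 / n.+1] for all radii up to [n], so a fixed radius is
    served by all but finitely many models. *)
Lemma sofic_action_of_treeing (R : realType) (mu : {measure set X -> \bar R})
    (S : nat -> X -> X) :
  mu setT = 1%:E -> (forall i, borel_mp_involution mu (S i)) ->
  treeing mu S -> sofic_action mu (invol_step S).
Proof.
move=> mu1 HS tree.
pose fam := {Y : finType & ((Y -> nat -> bool) * (nat -> {perm Y}))%type}.
have /choice[p Hp] (n : nat) : exists p : fam, (0 < #|tag p|)%N /\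
    forall (r : nat) (a : Defs.rgraph r), (r <= n)%N ->
      p_X mu (invol_step S) a \is a fin_num /\
      `|p_fin R (tagged p).2 (tagged p).1 a - fine (p_X mu (invol_step S) a)|
        <= n.+1%:R^-1.
  have [|Y [lab [sigma H]]] := @sofic_action_at_scale R mu S n n.+1%:R^-1 mu1 HS tree.
    by rewrite invr_gt0 ltr0n.
  by exists (existT _ Y (lab, sigma)).
exists (fun n => tag (p n)), (fun n => (tagged (p n)).1), (fun n => (tagged (p n)).2).
split=> [n|r a]; first by case: (Hp n).
have fin : p_X mu (invol_step S) a \is a fin_num by have [_ /(_ r a (leqnn r))[]] := Hp r.
rewrite -(fineK fin); apply: cvg_EFin; first by near=> n.
apply/cvgrPdist_le => e e0; near=> n => /=.
rewrite distrC; apply: (@le_trans _ _ n.+1%:R^-1).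
  have [_ /(_ r a)[]] := Hp n; last by [].
  by near: n; exact: nbhs_infty_ge.
by near: n; apply: filterS (near_infty_natSinv_lt (PosNum e0)) => k /ltW.
Unshelve. all: by end_near.
Qed.

(** * Actions of free groups *)

Definition partial_swap (f fi : X -> X) (A : set X) (x : X) : X :=
  if `[< A x >] then f x else if `[< A (fi x) >] then fi x else x.

Section PartialSwap.
Variables (R : realType) (mu : {measure set X -> \bar R}).
Variables (f fi : X -> X) (A : set X).
Hypothesis fK : cancel f fi.
Hypothesis fiK : cancel fi f.
Hypothesis A_disjoint : forall x, A x -> ~ A (f x).

Lemma partial_swap_in x : A x -> partial_swap f fi A x = f x.
Proof. by move=> Ax; rewrite /partial_swap asboolT. Qed.

Lemma partial_swap_image x : A (fi x) -> partial_swap f fi A x = fi x.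
Proof.
move=> Ax; rewrite /partial_swap asboolF; first by rewrite asboolT.
by have := A_disjoint Ax; rewrite fiK.
Qed.

Lemma partial_swap_out x : ~ A x -> ~ A (fi x) -> partial_swap f fi A x = x.
Proof. by move=> nA nA'; rewrite /partial_swap !asboolF. Qed.

Lemma partial_swapK : involutive (partial_swap f fi A).
Proof.
move=> x; case: (pselect (A x)) => Ax.
  by rewrite (partial_swap_in Ax) partial_swap_image fK.
case: (pselect (A (fi x))) => Afx.
  by rewrite (partial_swap_image Afx) partial_swap_in ?fiK.
by rewrite !partial_swap_out.
Qed.

Lemma partial_swap_preimage (B : set X) :
  [/\ partial_swap f fi A @^-1` B `&` A = A `&` f @^-1` B,
      partial_swap f fi A @^-1` B `&` fi @^-1` A = fi @^-1` (A `&` B) &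
      partial_swap f fi A @^-1` B `&` ~` (A `|` fi @^-1` A) =
        B `&` ~` (A `|` fi @^-1` A)].
Proof.
split; apply/seteqP; split=> x /= [].
- by move=> Bx Ax; rewrite partial_swap_in in Bx.
- by move=> Ax Bx; rewrite partial_swap_in.
- by move=> Bx Ax; rewrite partial_swap_image in Bx.
- by move=> Ax Bx; rewrite partial_swap_image.
- move=> Bx nA; rewrite partial_swap_out in Bx => //.
  + by move=> Ax; apply: nA; left.
  + by move=> Ax; apply: nA; right.
- move=> Bx nA; rewrite partial_swap_out //.
  + by move=> Ax; apply: nA; left.
  + by move=> Ax; apply: nA; right.
Qed.

Hypothesis mf : measurable_fun setT f.
Hypothesis mfi : measurable_fun setT fi.
Hypothesis fmp : measure_preserving mu f.
Hypothesis fimp : measure_preserving mu fi.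
Hypothesis mA : measurable A.

Let measurable_preimage (h : X -> X) (B : set X) :
  measurable_fun setT h -> measurable B -> measurable (h @^-1` B).
Proof. by move=> mh mB; rewrite -[X in measurable X]setTI; exact: mh. Qed.

Let three_pieces (B : set X) :
  B = (B `&` A) `|` ((B `&` fi @^-1` A) `|` (B `&` ~` (A `|` fi @^-1` A))).
Proof. by rewrite -setIUr -setIUr setUA setUv setIT. Qed.

Let mass_three_pieces (B : set X) : measurable B ->
  mu B = (mu (B `&` A) + (mu (B `&` fi @^-1` A) +
          mu (B `&` ~` (A `|` fi @^-1` A))))%E.
Proof.
move=> mB; have mfA := measurable_preimage mfi mA.
have mC : measurable (~` (A `|` fi @^-1` A)) by apply: measurableC; exact: measurableU.
rewrite -measureU; last 1 first.
- by apply/seteqP; split=> x //= [[_ Ax] [_ nA]]; apply: nA; right.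
- rewrite -measureU -?three_pieces //.
  + exact: measurableI.
  + by apply: measurableU; exact: measurableI.
  + apply/seteqP; split=> x //= [[_ Ax] [[_ Afx]|[_ nA]]]; last by apply: nA; left.
    by have := A_disjoint Afx; rewrite fiK.
- exact: measurableI.
- exact: measurableI.
Qed.

(** [X] splits into [A], its image under [f], and the rest, where the map is [f], [fi] and the
    identity; the masses of the first two pieces trade places. *)
Lemma partial_swap_borel_mp : borel_mp_involution mu (partial_swap f fi A).
Proof.
have mfA := measurable_preimage mfi mA.
have mS (B : set X) : measurable B -> measurable (partial_swap f fi A @^-1` B).
  move=> mB; rewrite [X in measurable X]three_pieces.
  have [-> -> ->] := partial_swap_preimage B.
  apply: measurableU; first by apply: measurableI => //; exact: measurable_preimage.
  apply: measurableU; first by apply: measurable_preimage => //; exact: measurableI.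
  by apply: measurableI => //; apply: measurableC; exact: measurableU.
split.
- by move=> _ B mB; rewrite setTI; exact: mS.
- exact: partial_swapK.
- move=> B mB; rewrite (mass_three_pieces (mS B mB)) (mass_three_pieces mB).
  have [-> -> ->] := partial_swap_preimage B.
  have -> : mu (fi @^-1` (A `&` B)) = mu (B `&` A).
    by rewrite (fimp (measurableI _ _ mA mB)) setIC.
  have -> : mu (A `&` f @^-1` B) = mu (B `&` fi @^-1` A).
    rewrite -(fimp (measurableI _ _ mA (measurable_preimage mf mB))).
    congr (mu _); apply/seteqP.
    by split=> x /= []; rewrite fiK; split.
  by rewrite !addeA [X in (X + _)%E]addeC.
Qed.

End PartialSwap.

(* When [f] has no fixed point these sets partition [X], and none of them meets
   its image under [f]; this is what cuts [f] into involutions. *)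
Definition first_difference (f : X -> X) (n : nat) (e : bool) : set X :=
  [set x : X | [/\ x n = e, f x n = ~~ e & forall m, (m < n)%N -> x m = f x m]].

Lemma first_difference_measurable f n e :
  measurable_fun setT f -> measurable (first_difference f n e).
Proof.
move=> mf.
have mc j b : measurable [set x | f x j = b].
  rewrite -[X in measurable X]setTI.
  exact: (mf measurableT _ (measurable_coordinate j b)).
rewrite (_ : first_difference f n e = [set x : X | x n = e] `&`
    ([set x | f x n = ~~ e] `&` \bigcap_(m in [set m | (m < n)%N])
      \bigcup_(b in [set: bool]) ([set x : X | x m = b] `&` [set x | f x m = b]))).
  apply: measurableI; first exact: measurable_coordinate.
  apply: measurableI; first exact: mc.
  apply: bigcap_measurableType => m _; apply: fin_bigcup_measurable => // b _.
  by apply: measurableI; [exact: measurable_coordinate|exact: mc].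
apply/seteqP; split=> x.
  by move=> [h1 h2 h3]; split=> //; split=> // m /h3 E; exists (x m).
move=> [h1 [h2 h3]]; split=> // m mn.
by have [b _ [/= -> ->]] := h3 m mn.
Qed.

Lemma first_difference_disjoint f n e x :
  first_difference f n e x -> ~ first_difference f n e (f x).
Proof. by move=> [_ h _] [h' _ _]; move: h; rewrite h'; case: e {h'}. Qed.

Lemma first_difference_unique f n e n' e' x :
  first_difference f n e x -> first_difference f n' e' x -> (n, e) = (n', e').
Proof.
move=> [h1 h2 h3] [h1' h2' h3'].
have [nn'|nn'|E] := ltngtP n n'.
- by move: (h3' _ nn'); rewrite h1 h2; case: (e).
- by move: (h3 _ nn'); rewrite h1' h2'; case: (e').
- by subst n'; rewrite -h1 -h1'.
Qed.

Lemma first_difference_exists f x :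
  f x <> x -> exists n e, first_difference f n e x.
Proof.
move=> fx; have ex : exists n, x n != f x n.
  apply: contrapT => nx; apply: fx; apply/funext => n.
  by apply/eqP; rewrite eq_sym; apply: contra_notT nx => ?; exists n.
exists (ex_minn ex), (x (ex_minn ex)); case: ex_minnP => n xn minn; split=> //.
  by move: xn; case: (x n); case: (f x n).
by move=> m mn; apply/eqP; apply: contraLR mn => /minn; rewrite -leqNgt.
Qed.

Section FreeActionTreeing.
Variables (R : realType) (mu : {measure set X -> \bar R}).
Variables (J : set nat) (g gi : nat -> X -> X).
Hypothesis gfree : free_action mu J g gi.

(** The index codes a generator together with a piece of its first-difference partition; other codes
    give the identity, which adds no edge. *)
Definition free_treeing (i : nat) : X -> X :=
  match @pickle_inv (nat * (nat * bool))%type i with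
  | Some (j, (n, e)) =>
      if `[< J j >] then partial_swap (g j) (gi j) (first_difference (g j) n e)
      else id
  | None => id
  end.

(** The source of the generator edge that the letter [l] crosses from [x]; the piece containing this
    source labels the edge, whichever way it is crossed. *)
Let base (l : letter) (x : X) : X := if l.2 then x else gi l.1 x.

Let labels (i : nat) (x : X) (l : letter) : Prop :=
  J l.1 /\ exists n e, i = pickle (l.1, (n, e)) /\
    first_difference (g l.1) n e (base l x).

Lemma free_treeing_borel_mp i : borel_mp_involution mu (free_treeing i).
Proof.
have id_mp : borel_mp_involution mu id by split=> //; exact: measurable_id.
rewrite /free_treeing; case: pickle_inv => [[j [n e]]|] //.
case: asboolP => // Jj.
have [[gK giK] mg mgi gmp gimp] := (proj1 gfree) _ Jj.
apply: partial_swap_borel_mp => //; last exact: first_difference_measurable.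
exact: first_difference_disjoint.
Qed.

Lemma free_treeing_labels i x l :
  labels i x l -> free_treeing i x = gen_step g gi l.1 l.2 x.
Proof.
case: l => j s [/= Jj [n [e [-> fd]]]].
have [[gK giK] _ _ _ _] := (proj1 gfree) _ Jj.
rewrite /free_treeing pickleK_inv asboolT // /gen_step.
move: fd; rewrite /base /=; case: s => fd; first exact: partial_swap_in.
by apply: partial_swap_image => //; exact: first_difference_disjoint.
Qed.

Lemma free_treeing_moves i x :
  free_treeing i x <> x -> exists l, labels i x l.
Proof.
rewrite /free_treeing; case E: pickle_inv => [[j [n e]]|] //.
have ii : i = pickle (j, (n, e)).
  by have := @pickle_invK (nat * (nat * bool))%type i; rewrite /oapp E => <-.
case: asboolP => // Jj.
case: (pselect (first_difference (g j) n e x)) => fd.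
  by move=> _; exists (j, true); split=> //; exists n, e.
case: (pselect (first_difference (g j) n e (gi j x))) => fd'.
  by move=> _; exists (j, false); split=> //; exists n, e.
by rewrite partial_swap_out.
Qed.

Lemma free_treeing_covers j s x : J j -> exists i, labels i x (j, s).
Proof.
move=> Jj; pose p := base (j, s) x.
have gp : g j p <> p.
  apply: (proj2 gfree p [:: (j, true)]) => // l.
  by rewrite inE => /eqP ->.
have [n [e fd]] := first_difference_exists gp.
by exists (pickle (j, (n, e))); split=> //; exists n, e.
Qed.

(** Both crossings have the same [base], and a point lies in only one piece. *)
Lemma free_treeing_backtrack i i' x j s :
  labels i x (j, s) -> labels i' (gen_step g gi j s x) (j, ~~ s) -> i = i'.
Proof.
move=> [/= Jj [n [e [-> fd]]]] [_ [n' [e' [-> fd']]]].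
have [[gK giK] _ _ _ _] := (proj1 gfree) _ Jj.
suff /first_difference_unique -/(_ _ _ fd) -> : first_difference (g j) n' e' (base (j, s) x) by [].
by move: fd'; rewrite /base /gen_step /=; case: (s) => //=; rewrite gK.
Qed.

(* Since an edge carries a single label, a cycle with distinct edges never
   crosses an edge back, so that it spells a reduced word fixing a point. *)
Lemma free_treeing_no_cycle y l : ~ is_cycle free_treeing y l.
Proof.
pose k := size l; pose v j := nth y (walk free_treeing y l) j.
case; rewrite -/k -/v => k0 vk step _ edges.
have vS j : (j < k)%N -> v j.+1 = free_treeing (nth 0%N l j) (v j).
  move=> jk; rewrite /v !nth_walk ?(ltnW jk) //.
  by rewrite (take_nth 0%N) // -cats1 run_cat.
have /choice[c Hc] (j : nat) : exists c : letter, (j < k)%N -> labels (nth 0%N l j) (v j) c.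
  have [jk|jk] := ltnP j k; last by exists (0%N, true).
  have moved : free_treeing (nth 0%N l j) (v j) <> v j by rewrite -vS //; exact: step.
  by have [c Hc] := free_treeing_moves moved; exists c.
have vc j : (j < k)%N -> v j.+1 = gen_step g gi (c j).1 (c j).2 (v j).
  by move=> jk; rewrite vS // (free_treeing_labels (Hc j jk)).
have run_c m : (m <= k)%N -> act_word (gen_step g gi) (rev (mkseq c m)) (v 0%N) = v m.
  elim: m => [//|m IH] mk.
  by rewrite mkseqS rev_rcons /= IH ?(ltnW mk) // vc.
have red m : (m <= k)%N -> reduced_word (rev (mkseq c m)).
  elim: m => [//|m IH] mk; rewrite mkseqS rev_rcons.
  case: m IH mk => [//|m] IH mk; have := IH (ltnW mk).
  rewrite mkseqS rev_rcons => red_m; apply/andP; split; last exact: red_m.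
  apply/negP => /andP[/eqP c1 c2].
  have c2' : (c m.+1).2 = ~~ (c m).2 by move: c2; do 2 case: (_.2).
  have Hm := Hc m (ltnW mk); have Hm1 := Hc m.+1 mk.
  rewrite vc ?(ltnW mk) // in Hm1.
  have E : nth 0%N l m = nth 0%N l m.+1.
    apply: (@free_treeing_backtrack _ _ (v m) (c m).1 (c m).2).
      by rewrite -surjective_pairing.
    rewrite (_ : ((c m).1, ~~ (c m).2) = c m.+1) //.
    by rewrite [RHS]surjective_pairing c1 c2'.
  have [_ inv _] := free_treeing_borel_mp (nth 0%N l m).
  have vm2 : v m.+2 = v m by rewrite vS // vS ?(ltnW mk) // -E inv.
  apply: (edges m m.+1); first by rewrite ltnSn.
  by split=> //; right; split=> //; exact: esym vm2.
have v0 : v 0%N = y by rewrite /v; case: (l).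
have := run_c k (leqnn k); rewrite v0 [v k]vk; apply: (proj2 gfree).
- move=> /(congr1 size); rewrite size_rev size_mkseq /= => k0'.
  by rewrite k0' in k0.
- exact: red.
- move=> a; rewrite mem_rev => /mapP[j]; rewrite mem_iota /= add0n => jk ->.
  by have [] := Hc j jk.
Qed.

(** Every generator step is a labelled edge by [free_treeing_covers], and every nontrivial labelled
    step is a generator step by [free_treeing_moves]. *)
Lemma free_treeing_orbits x y :
  orbit_rel_in J g gi x y <-> orbit_rel (invol_step free_treeing) x y.
Proof.
split.
- move=> [w [wJ <-]]; elim: w wJ => [|[j s] w IH] wJ; first by exists [::].
  have [|w' Ew'] := IH; first by move=> l lw; apply: wJ; rewrite inE lw orbT.
  have [|i Hi] := @free_treeing_covers j s (act_word (gen_step g gi) w x).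
    by apply: (wJ (j, s)); rewrite inE eqxx.
  by exists ((i, true) :: w'); rewrite /= Ew' /invol_step (free_treeing_labels Hi).
- move=> [w <-]; elim: w => [|[i s] w [w' [wJ Ew']]]; first by exists [::].
  rewrite /= /invol_step -/(invol_step free_treeing).
  case: (pselect (free_treeing i (act_word (invol_step free_treeing) w x) =
                  act_word (invol_step free_treeing) w x)) => [->|ne].
    by exists w'.
  have [l Hl] := free_treeing_moves ne.
  exists (l :: w'); split; last by rewrite /= Ew' (free_treeing_labels Hl).
  by move=> a; rewrite inE => /predU1P[->|/wJ //]; case: Hl.
Qed.

Lemma free_action_treeable : treeable mu (orbit_rel_in J g gi).
Proof.
exists free_treeing; split; first exact: free_treeing_borel_mp.
- by apply: aeW => x [y [l [_]]]; exact: free_treeing_no_cycle.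
- exact: free_treeing_orbits.
Qed.

End FreeActionTreeing.

Lemma treeable_sofic (R : realType) (mu : {measure set X -> \bar R})
    (E : X -> X -> Prop) :
  mu setT = 1%:E -> treeable mu E -> sofic_relation mu E.
Proof.
move=> mu1 [S [HS tree orb]]; exists S, S.
have stepE : gen_step S S = invol_step S.
  by apply/funext => i; apply/funext => -[].
split; last by rewrite stepE.
- by move=> i; have [mS SK Smp] := HS i; split.
- by rewrite stepE; exact: sofic_action_of_treeing.
Qed.

Theorem theorem7p4 (R : realType) (mu : {measure set X -> \bar R})
  (Hmu : uniform_product_measure mu) :
  (forall S : nat -> X -> X,
     (forall i, borel_mp_involution mu (S i)) -> treeing mu S ->
     sofic_action mu (invol_step S)) /\
  (forall E : X -> X -> Prop, treeable mu E -> sofic_relation mu E) /\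
  (forall (J : set nat) (g gi : nat -> X -> X),
     free_action mu J g gi -> sofic_relation mu (orbit_rel_in J g gi)).
Proof.
have mu1 : mu setT = 1%:E.
  (* The cylinder prescribing no digit is the whole space. *)
  have := Hmu 0%N (fun=> true); rewrite expr0 invr1 => <-.
  by congr (mu _); apply/seteqP; split.
split; first by move=> S; exact: sofic_action_of_treeing.
split; first by move=> E; exact: treeable_sofic.
by move=> J g gi /free_action_treeable; exact: treeable_sofic.
Qed.
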